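(* Let $G$ be a group, let $T$ be a $G$-tree whose edge stabilizers are finite, and let $U$ be any $G$-retract of the $G$-set $VT$. Then there exists a $G$-tree whose edge stabilizers are finite and whose vertex set is the $G$-set $U$.
   Context: All $G$-actions are left actions; $G_x$ denotes the stabilizer of $x$. A $G$-graph consists of a nonempty $G$-set $V$ (vertices), a $G$-set $E$ (edges) and $G$-maps $\iota,\tau\colon E\to V$ (initial and terminal vertex maps); so edges are oriented and $G$ preserves the orientation. A $G$-tree $T$ is a $G$-graph whose underlying graph (forgetting orientation) is a tree; its vertex set is denoted $VT$ and its edge set $ET$. A $G$-retract $U$ of a $G$-set $V$ is a $G$-subset (a subset closed under the $G$-action) of $V$ such that, for each $w\in V-U$, there exists $u\in U$ with $G_w\le G_u$; equivalently, there exists a $G$-map $V\to U$ which is the identity on $U$. *)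

(* Defs.v *)
From Stdlib Require List.
From mathcomp Require Import all_boot.
From mathcomp Require Import boolp classical_sets functions cardinality.
Set Implicit Arguments.
Unset Strict Implicit.
Unset Printing Implicit Defensive.

Local Open Scope classical_set_scope.
Local Open Scope group_scope.

(* Left actions of an arbitrary, possibly infinite, group. *)
Record gset (G : groupType) := GSet {
  gset_sort :> Type;
  act : G -> gset_sort -> gset_sort;
  act1 : forall x, act 1 x = x;
  actM : forall g h x, act (g * h) x = act g (act h x)
}.

Definition stabilizer (G : groupType) (X : gset G) (x : X) : set G :=
  [set g | act g x = x].

Record gsubset (G : groupType) (X : gset G) := GSubset {
  gsubset_set :> set X;
  gsubset_closed : forall g x, gsubset_set x -> gsubset_set (act g x)
}.

Section GSubsetGSet.
Variables (G : groupType) (X : gset G) (U : gsubset X).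

Definition gsubset_act (g : G) (x : set_type U) : set_type U :=
  SigSub (mem_set (gsubset_closed g (set_valP x))).

Lemma gsubset_act1 (x : set_type U) : gsubset_act 1 x = x.
Proof. by apply: val_inj; rewrite /= act1. Qed.

Lemma gsubset_actM (g h : G) (x : set_type U) :
  gsubset_act (g * h) x = gsubset_act g (gsubset_act h x).
Proof. by apply: val_inj; rewrite /= actM. Qed.

Definition gset_of_gsubset : gset G := GSet gsubset_act1 gsubset_actM.
End GSubsetGSet.

Definition gretract (G : groupType) (V : gset G) (U : gsubset V) : Prop :=
  forall w : V, ~ gsubset_set U w ->
    exists2 u : V, gsubset_set U u & stabilizer w `<=` stabilizer u.

(* The vertex G-set is a parameter, so that "a G-graph whose vertex set is the
   G-set V" is literally a term of type [ggraph V].  Loops and multiple edges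
   are allowed. *)
Record ggraph (G : groupType) (V : gset G) := GGraph {
  edges : gset G;
  iota_v : edges -> V;
  tau_v : edges -> V;
  ggraph_nonempty : exists v : V, True;
  iota_act : forall g e, iota_v (act g e) = act g (iota_v e);
  tau_act : forall g e, tau_v (act g e) = act g (tau_v e)
}.

Section Trees.
Variables (G : groupType) (V : gset G) (T : ggraph V).

(* Orientation is forgotten by letting paths cross edges both ways: a step
   [(e, true)] crosses [e] from [iota_v e] to [tau_v e], and [(e, false)]
   crosses it backwards. *)
Definition step : Type := (edges T * bool)%type.

Definition step_source (s : step) : V := if s.2 then iota_v s.1 else tau_v s.1.
Definition step_target (s : step) : V := if s.2 then tau_v s.1 else iota_v s.1.

Fixpoint is_walk (v w : V) (p : seq step) : Prop :=
  if p is s :: p' then step_source s = v /\ is_walk (step_target s) w p'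
  else v = w.

Definition connected_graph : Prop := forall v w : V, exists p, is_walk v w p.

(* A circuit has length at least 1; a loop is a circuit of length 1, and two
   parallel edges give a circuit of length 2.  The distinctness of the edges
   excludes crossing an edge and coming straight back. *)
Definition is_circuit (p : seq step) : Prop :=
  [/\ p <> [::],
      exists v, is_walk v v p,
      List.NoDup [seq step_source s | s <- p] &
      List.NoDup [seq s.1 | s <- p]].

Definition is_gtree : Prop :=
  connected_graph /\ forall p, ~ is_circuit p.

Definition finite_edge_stabilizers : Prop :=
  forall e : edges T, finite_set (stabilizer e).
End Trees.

(* Main.v *)
Require Import Defs.
From mathcomp Require Import all_boot.
From mathcomp Require Import zify.
From mathcomp Require Import boolp classical_sets cardinality.
From Stdlib Require List.

(** Write G_x for the stabilizer of x. A vertex w outside U has G_w <= G_u for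
some u in U. A shortest walk from w to u is fixed by G_w, so its first edge e
has G_e = G_w; in particular G_w is finite. If the walk does not come back to
the orbit of w, which can be arranged because a finite group is not properly
contained in a conjugate of itself, then one may cut the orbit of e and merge
each gw with gu: the result is again a tree with finite edge stabilizers, with
one orbit of vertices less ([stage_join]). When finitely many orbits lie outside
U, repeating this proves the theorem.

In general the construction needs limits, and it has to be kept convergent. The
trees met on the way are recorded by stages: a [fold], which sends a vertex of
[T] to the vertex it has been merged into, and a set of [cut] edges of [T]. Only
loose edges are ever cut: those with an end x outside U such that G_x <= G_e and
the other end lies outside the orbit of x. An edge that is not loose never
becomes loose ([tight_map]), so it survives forever. A stage is therefore
required to join the ends of every cut edge by a walk along uncut edges that are
not loose; this walk persists, so connectedness passes to limits, while
acyclicity does because a circuit is finite ([stage_limit]).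

To send w into U under this requirement, first contract the loose edges on the
shortest walk from w to u, apart from its first edge, and then merge w with u
([stage_step]). The contractions merge finitely many orbits of vertices into
vertices that may still lie outside U; the next round sends these into U, at the
price of finitely many new ones. After infinitely many rounds every vertex that
has moved at all lies in U ([full_extension]). Stages with this property are
closed under limits of chains, and Zorn's lemma provides one that folds all of V
into U ([complete_stage_exists]); its graph is the required tree. *)

Set Implicit Arguments.
Unset Strict Implicit.
Unset Printing Implicit Defensive.

Local Open Scope classical_set_scope.
Local Open Scope group_scope.

(** * Orbits and stabilizers *)

Section Actions.
Variables (G : groupType) (X : gset G).
Implicit Types (g : G) (x y : X).

Definition same_orbit x y := exists g, y = act g x.

Lemma actK g x : act g^-1 (act g x) = x.
Proof. by rewrite -actM mulVg act1. Qed.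

Lemma actKV g x : act g (act g^-1 x) = x.
Proof. by rewrite -actM mulgV act1. Qed.

Lemma same_orbit_refl x : same_orbit x x.
Proof. by exists 1; rewrite act1. Qed.

Lemma same_orbit_act g x y : same_orbit x y -> same_orbit x (act g y).
Proof. by case=> h ->; exists (g * h); rewrite actM. Qed.

Lemma same_orbit_actV g x y : same_orbit x (act g y) -> same_orbit x y.
Proof. by move=> /(same_orbit_act g^-1); rewrite actK. Qed.

Lemma same_orbit_sym x y : same_orbit x y -> same_orbit y x.
Proof. by case=> g ->; exists g^-1; rewrite actK. Qed.

Lemma stabilizer_act g h x :
  stabilizer (act g x) h <-> stabilizer x (g^-1 * h * g).
Proof.
rewrite /stabilizer /= !actM; split=> [->|E]; first exact: actK.
by rewrite -{2}E actKV.
Qed.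

(** Stabilizers of vertices in one orbit are conjugate, and a finite group
contains no proper conjugate of itself. *)
Lemma stabilizer_orbit_eq g x : finite_set (stabilizer x) ->
  stabilizer x `<=` stabilizer (act g x) ->
  stabilizer (act g x) `<=` stabilizer x.
Proof.
move=> /finite_seqP[s0 Es0] sub.
pose s := undup s0.
have sP h : (h \in s) <-> stabilizer x h by rewrite mem_undup Es0.
pose k h := g^-1 * h * g.
have k_inj : injective k by move=> a b /mulIg /mulgI.
have ks : {subset [seq k h | h <- s] <= s}.
  move=> _ /mapP[h /sP hx ->]; apply/sP.
  exact/stabilizer_act/sub.
have us : uniq [seq k h | h <- s] by rewrite map_inj_uniq ?undup_uniq.
have [_ ksE] : (size [seq k h | h <- s] = size s) * ([seq k h | h <- s] =i s).
  by apply: uniq_min_size us ks _; rewrite size_map.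
move=> h /stabilizer_act/sP.
by rewrite -ksE => /mapP[h' /sP h'x /k_inj ->].
Qed.

End Actions.

(** * Walks and acyclicity *)

Lemma In_mapP (A B : Type) (f : A -> B) (p : seq A) (y : B) :
  List.In y (map f p) -> exists2 x, List.In x p & y = f x.
Proof.
elim: p => //= x p IH [<-|/IH[x' x'p ->]]; first by exists x; [left|].
by exists x'; [right|].
Qed.

Lemma not_NoDup_map (A B : Type) (f : A -> B) (p : seq A) :
  ~ List.NoDup (map f p) -> exists p1 s1 p2 s2 p3,
    p = p1 ++ s1 :: p2 ++ s2 :: p3 /\ f s1 = f s2.
Proof.
elim: p => [|s p IH] /=; first by case; constructor.
have [fsp _|fsp dup] := pselect (List.In (f s) (map f p)).
  have [s2 s2p fs2] := In_mapP fsp.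
  have [p2 [p3 ->]] := List.in_split _ _ s2p.
  by exists [::], s, p2, s2, p3.
have [|p1 [s1 [p2 [s2 [p3 [-> E]]]]]] := IH.
  by move=> nd; apply: dup; constructor.
by exists (s :: p1), s1, p2, s2, p3.
Qed.

Section Walks.
Variables (G : groupType) (V : gset G) (T : ggraph V).
Implicit Types (f : V -> V) (Q : set (edges T)) (c : edges T -> bool).
Implicit Types (s : step T) (p q : seq (step T)) (g : G).

Definition flip s : step T := (s.1, ~~ s.2).
Definition act_step g s : step T := (act g s.1, s.2).

Lemma source_flip s : step_source (flip s) = step_target s.
Proof. by case: s => e []. Qed.

Lemma target_flip s : step_target (flip s) = step_source s.
Proof. by case: s => e []. Qed.

Lemma source_act g s : step_source (act_step g s) = act g (step_source s).
Proof. by case: s => e []; rewrite /step_source /= ?iota_act ?tau_act. Qed.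

Lemma target_act g s : step_target (act_step g s) = act g (step_target s).
Proof. by case: s => e []; rewrite /step_target /= ?iota_act ?tau_act. Qed.

(** Walks in the graph whose edges are the edges of [T] in [Q], with every
endpoint moved by [f]. The steps remain steps of [T], so that one list of steps
can be read in several of these graphs. *)
Fixpoint walk f Q (a b : V) p : Prop :=
  if p is s :: p' then
    [/\ Q s.1, f (step_source s) = a & walk f Q (f (step_target s)) b p']
  else a = b.

Lemma walk_idE a b p : walk id setT a b p <-> is_walk a b p.
Proof.
elim: p a => //= s p IH a; split; first by case=> _ -> /IH.
by case=> -> /IH.
Qed.

Definition xsum c p : bool := \big[addb/false]_(s <- p) c s.1.

Lemma xsum_nil c : xsum c [::] = false.
Proof. exact: big_nil. Qed.

Lemma xsum_cons c s p : xsum c (s :: p) = c s.1 (+) xsum c p.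
Proof. exact: big_cons. Qed.

Lemma xsum_cat c p q : xsum c (p ++ q) = xsum c p (+) xsum c q.
Proof. exact: big_cat. Qed.

Lemma walk_cat f Q a b d p q :
  walk f Q a b p -> walk f Q b d q -> walk f Q a d (p ++ q).
Proof.
by elim: p a => [|s p IH] a /= => [-> //|[Qs fs wp] wq]; split=> //; apply: IH.
Qed.

Lemma walk_catP f Q a b p q :
  walk f Q a b (p ++ q) -> exists2 d, walk f Q a d p & walk f Q d b q.
Proof.
elim: p a => [|s p IH] a /=; first by exists a.
by case=> Qs fs /IH[d wp wq]; exists d.
Qed.

Lemma walk_rev f Q a b p :
  walk f Q a b p -> walk f Q b a (rev (map flip p)).
Proof.
elim: p a => [|s p IH] a //= [Qs fs /IH wp].
rewrite rev_cons -cats1; apply: walk_cat wp _.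
by split; rewrite ?source_flip ?target_flip.
Qed.

Lemma xsum_rev c p : xsum c (rev (map flip p)) = xsum c p.
Proof.
elim: p => //= s p IH.
by rewrite rev_cons -cats1 xsum_cat IH !xsum_cons xsum_nil addbF addbC.
Qed.

Lemma walk_suffix f Q a b p s : walk f Q a b p -> List.In s p ->
  exists2 q, walk f Q (f (step_target s)) b q & (size q < size p)%N.
Proof.
elim: p a => //= s' p IH a [_ _ wp] [<-|/(IH _ wp)[q wq lt]].
  by exists p.
by exists q => //; apply: ltnW.
Qed.

Lemma walk_edge f Q a b p s : walk f Q a b p -> List.In s p -> Q s.1.
Proof. by elim: p a => //= s' p IH a [Qs _ wp] [<-|/(IH _ wp)]. Qed.

Lemma walk_source f Q a b p s : walk f Q a b p -> List.In s p ->
  f (step_source s) = a \/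
  exists2 s', List.In s' p & f (step_source s) = f (step_target s').
Proof.
elim: p a => //= s' p IH a [_ fs wp] [<-|sp]; first by left.
right; have [->|[s2 s2p ->]] := IH _ wp sp; first by exists s'; [left|].
by exists s2; [right|].
Qed.

Lemma walk_map f Q f' Q' a b p : (forall v, f' (f v) = f' v) -> Q `<=` Q' ->
  walk f Q a b p -> walk f' Q' (f' a) (f' b) p.
Proof.
move=> ff sub; elim: p a => [|s p IH] a /= => [-> //|[Qs <- /IH wp]].
by split; rewrite ?ff; [apply: sub| |move: wp; rewrite ff].
Qed.

Lemma walk_all f Q Q' a b p : (forall s, List.In s p -> Q' s.1) ->
  walk f Q a b p -> walk f Q' a b p.
Proof.
elim: p a => [|s p IH] a //= pQ' [Qs fs wp].
by split=> //; [apply: pQ'; left|apply: IH wp => s' ?; apply: pQ'; right].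
Qed.

Lemma walk_sub f Q Q' a b p : Q `<=` Q' -> walk f Q a b p -> walk f Q' a b p.
Proof.
move=> sub; elim: p a => [|s p IH] a //= [Qs fs /IH wp].
by split=> //; apply: sub.
Qed.

Lemma walk_act f Q g a b p : (forall v, f (act g v) = act g (f v)) ->
  (forall e, Q e -> Q (act g e)) ->
  walk f Q a b p -> walk f Q (act g a) (act g b) (map (act_step g) p).
Proof.
move=> fg Qg; elim: p a => [|s p IH] a /= => [-> //|[Qs <- /IH wp]].
by rewrite source_act target_act !fg; split=> //; apply: Qg.
Qed.

Lemma walk_collapse f Q f' (D : set (edges T)) a b p :
  (forall v, f' (f v) = f' v) ->
  (forall e, D e -> f' (iota_v e) = f' (tau_v e)) ->
  walk f Q a b p ->
  walk f' (Q `\` D) (f' a) (f' b) [seq s <- p | `[< ~ D s.1 >]].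
Proof.
move=> ff fD; elim: p a => [|s p IH] a /= => [-> //|[Qs <- /IH wp]].
rewrite !ff in wp *; case: asboolP => [Ds|/contrapT Ds] /=; first by split.
suff <- : f' (step_target s) = f' (step_source s) by [].
by rewrite /step_target /step_source; case: s.2; rewrite fD.
Qed.

Lemma size_collapse (D : set (edges T)) p s : List.In s p -> D s.1 ->
  (size [seq s <- p | `[< ~ D s.1 >]] < size p)%N.
Proof.
elim: p => //= s' p IH [->|/IH{}IH Ds].
  by move=> Ds; case: asboolP => // _; rewrite ltnS size_filter count_size.
case: asboolP => _ /=; first by rewrite ltnS IH.
by rewrite ltnS ltnW ?IH.
Qed.

Lemma xsum_walk f Q (c : edges T -> bool) (x : V -> bool) a b p :
  (forall e, Q e -> x (f (iota_v e)) (+) x (f (tau_v e)) = c e) ->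
  walk f Q a b p -> xsum c p = x a (+) x b.
Proof.
move=> dx; elim: p a => [|s p IH] a /=; first by move->; rewrite xsum_nil addbb.
case=> Qs <- /IH wp; rewrite xsum_cons wp -(dx _ Qs).
rewrite /step_target /step_source; case: s.2; first by rewrite -addbA addKb.
by rewrite [X in X (+) _]addbC -addbA addKb.
Qed.

Lemma xsum0 c p : (forall s, List.In s p -> c s.1 = false) -> xsum c p = false.
Proof.
elim: p => [|s p IH] cp; first exact: xsum_nil.
by rewrite xsum_cons cp ?IH //; [move=> s' ?; apply: cp; right|left].
Qed.

(** The graph has no cycles modulo 2: this form of acyclicity passes to
increasing unions, a closed walk having finitely many edges. *)
Definition acyclic f Q :=
  forall a p, walk f Q a a p -> forall c, xsum c p = false.

(** In a closed walk that is not a circuit, some vertex or some edge is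
repeated. A repeated vertex splits the walk into two closed walks; between two
passages through one edge in opposite directions, what precedes and what
follows are again closed walks. *)
Lemma acyclic_of_circuit_free :
  (forall p, ~ @is_circuit G V T p) -> acyclic id setT.
Proof.
move=> nocirc a p; have [n] := ubnP (size p).
elim: n a p => // n IH a p; rewrite ltnS => szp wp c.
have [p0|pn0] := pselect (p = [::]); first by rewrite p0 xsum_nil.
have [|dup] := pselect (List.NoDup [seq step_source s | s <- p]); last first.
  have [p1 [s1 [p2 [s2 [p3 [Ep Es]]]]]] := not_NoDup_map dup.
  move: wp szp; rewrite Ep !size_cat /= size_cat /= => /walk_catP[b wp1].
  rewrite -cat_cons => /walk_catP[b' wp2 wp3] szp.
  have E1 : b = step_source s1 by case: wp2.
  have E2 : b' = step_source s2 by case: wp3.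
  rewrite {b}E1 in wp1 wp2; rewrite {b'}E2 -Es in wp2 wp3.
  have c2 : xsum c (s1 :: p2) = false.
    by apply: (IH _ _ _ wp2); rewrite /=; lia.
  have c13 : xsum c (p1 ++ s2 :: p3) = false.
    apply: (IH _ _ _ (walk_cat wp1 wp3)); rewrite size_cat /=; lia.
  by rewrite xsum_cat [xsum c (_ ++ _)]xsum_cat c2 addFb -xsum_cat.
move=> nodup; have [nodupe|dup] := pselect (List.NoDup [seq s.1 | s <- p]).
  case: (nocirc p); split=> //; exists a; exact/walk_idE.
have [p1 [s1 [p2 [s2 [p3 [Ep Es]]]]]] := not_NoDup_map dup.
have Esf : s2 = flip s1.
  have : step_source s1 <> step_source s2.
    move=> E; move: nodup; rewrite Ep map_cat /= => nd.
    apply: (List.NoDup_remove_2 _ _ _ nd).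
    apply: List.in_or_app; right; rewrite E; apply: List.in_map.
    by apply: List.in_or_app; right; left.
  case: s1 s2 Es {Ep} => e d [e' d'] /= -> ; rewrite /flip /=.
  by case: d d' => [] [].
move: wp szp; rewrite Ep !size_cat /= size_cat /= => /walk_catP[b wp1].
move=> [_ /= E1 /walk_catP[b' wp2 [_ /= E2 wp3]]] szp.
rewrite -{b}E1 in wp1; rewrite -{b'}E2 Esf source_flip in wp2.
rewrite Esf target_flip in wp3.
have c2 : xsum c p2 = false.
  apply: (IH _ _ _ wp2); lia.
have c13 : xsum c (p3 ++ p1) = false.
  apply: (IH _ _ _ (walk_cat wp3 wp1)); rewrite size_cat; lia.
rewrite !(xsum_cat, xsum_cons) c2 -Es addFb addKb addbC -xsum_cat.
exact: c13.
Qed.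

(** A tree has trivial first cohomology modulo 2: integrate along chosen walks
from a base point. *)
Lemma acyclic_potential f Q c (b : V) :
  (forall v, exists p, walk f Q b (f v) p) -> acyclic f Q ->
  exists x : V -> bool,
    forall e, Q e -> x (f (iota_v e)) (+) x (f (tau_v e)) = c e.
Proof.
move=> conn acy.
have /choice[w wP] : forall a, exists p, (exists v, a = f v) -> walk f Q b a p.
  move=> a; have [[v ->]|nv] := pselect (exists v, a = f v).
    by have [p wp] := conn v; exists p.
  by exists [::] => /nv.
exists (fun a => xsum c (w a)) => e Qe.
have wi : walk f Q b (f (iota_v e)) (w (f (iota_v e))).
  by apply: wP; exists (iota_v e).
have wt : walk f Q b (f (tau_v e)) (w (f (tau_v e))).
  by apply: wP; exists (tau_v e).
have we : walk f Q (f (iota_v e)) (f (tau_v e)) [:: (e, true)] by [].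
have := acy _ _ (walk_cat wi (walk_cat we (walk_rev wt))) c.
rewrite !xsum_cat xsum_rev xsum_cons xsum_nil addbF /=.
by case: (xsum _ _); case: (xsum _ _); case: (c e).
Qed.

End Walks.

(** * Stages *)

Section Stages.
Variables (G : groupType) (V : gset G) (T : ggraph V) (U : gsubset V).
Local Notation inU := (gsubset_set U).
Implicit Types (e : edges T) (s : step T) (p q : seq (step T)) (g : G).

(** With [x] and [y] the ends of [e], the inclusion makes the
stabilizers of [x] and [e] equal: contracting the orbit of [e] then amounts to
removing the orbit of [x]. *)
Definition loose (x y : V) e :=
  [/\ ~ inU x, stabilizer x `<=` stabilizer e & ~ same_orbit x y].

Definition tight (f : V -> V) e :=
  ~ loose (f (iota_v e)) (f (tau_v e)) e /\
  ~ loose (f (tau_v e)) (f (iota_v e)) e.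

Definition safe (f : V -> V) (C : set (edges T)) : set (edges T) :=
  [set e | ~ C e /\ tight f e].

(** The tree of a stage has as vertices the fixed points of [fold], all other
vertices being isolated, and as edges those outside [cut]. *)
Record stage := Stage {
  fold :> V -> V;
  cut : set (edges T);
  fold_act : forall g v, fold (act g v) = act g (fold v);
  fold_idem : forall v, fold (fold v) = fold v;
  fold_U : forall u, inU u -> fold u = u;
  cut_act : forall g e, cut e -> cut (act g e);
  cut_bridged : forall e, cut e ->
    exists p, walk fold (safe fold cut) (fold (iota_v e)) (fold (tau_v e)) p;
  stage_acyclic : @acyclic G V T fold (~` cut)
}.
Implicit Types S : stage.

(** The last clause is what makes the walks of [cut_bridged] permanent. *)
Definition stage_le S S' :=
  [/\ forall v, S' (S v) = S' v, cut S `<=` cut S' &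
      forall e, safe S (cut S) e -> ~ cut S' e].

Lemma loose_map (f : V -> V) x y e :
  (forall g v, f (act g v) = act g (f v)) -> (forall u, inU u -> f u = u) ->
  loose (f x) (f y) e -> loose x y e.
Proof.
move=> fG fU [nU sub norb]; split.
- by move=> Ux; apply: nU; rewrite fU.
- by move=> g gx; apply: sub; rewrite /stabilizer /= -fG gx.
- by case=> g E; apply: norb; exists g; rewrite E fG.
Qed.

Lemma loose_act g x y e : loose (act g x) (act g y) (act g e) -> loose x y e.
Proof.
move=> [nU sub norb]; split.
- by move=> Ux; apply: nU; apply: gsubset_closed.
- move=> h hx; have : stabilizer (act g x) (g * h * g^-1).
    by rewrite /stabilizer /= 2!actM actK hx.
  by move=> /sub /stabilizer_act; rewrite !mulgA mulVg mul1g -mulgA mulVg mulg1.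
- case=> h E; apply: norb; exists (g * h * g^-1).
  by rewrite 2!actM actK E.
Qed.

Lemma tight_map (f f' : V -> V) e :
  (forall g v, f' (act g v) = act g (f' v)) -> (forall u, inU u -> f' u = u) ->
  (forall v, f' (f v) = f' v) -> tight f e -> tight f' e.
Proof.
by move=> fG fU ff [t1 t2]; split=> l;
  [apply: t1|apply: t2]; apply: (loose_map fG fU); rewrite !ff.
Qed.

Lemma tight_act (f : V -> V) g e :
  (forall g v, f (act g v) = act g (f v)) -> tight f e -> tight f (act g e).
Proof.
move=> fG [t1 t2]; split; rewrite iota_act tau_act !fG => /loose_act.
  exact: t1.
exact: t2.
Qed.

Lemma safe_act S g e : safe S (cut S) e -> safe S (cut S) (act g e).
Proof.
move=> [nc t]; split; last by apply: tight_act => //; apply: fold_act.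
by move/(cut_act g^-1); rewrite actK.
Qed.

Lemma uncut_act S g e : (~` cut S) e -> (~` cut S) (act g e).
Proof. by move=> nc /(cut_act g^-1); rewrite actK. Qed.

Lemma stabilizer_source S s :
  stabilizer s.1 `<=` stabilizer (S (step_source s)).
Proof.
case: s => e d g ge.
by rewrite /stabilizer /= -fold_act -source_act /act_step ge.
Qed.

Lemma stabilizer_target S s :
  stabilizer s.1 `<=` stabilizer (S (step_target s)).
Proof. by rewrite -source_flip; apply: (stabilizer_source S (s := flip s)). Qed.

Lemma stage_le_safe S S' : stage_le S S' ->
  safe S (cut S) `<=` safe S' (cut S').
Proof.
move=> [SS _ sc] e [nc t]; split; first exact: sc.
by apply: tight_map SS t; [apply: fold_act|apply: fold_U].
Qed.

Lemma stage_le_refl S : stage_le S S.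
Proof. by split=> // [v|e []] //; apply: fold_idem. Qed.

Lemma stage_le_trans S1 S2 S3 :
  stage_le S1 S2 -> stage_le S2 S3 -> stage_le S1 S3.
Proof.
move=> le12 le23; have [f12 c12 _] := le12; have [f23 c23 s23] := le23; split.
- by move=> v; rewrite -f23 f12 f23.
- exact: subset_trans c12 c23.
- by move=> e /(stage_le_safe le12)/s23.
Qed.

Lemma stage_connected S : connected_graph T ->
  forall a b, exists p, walk S (~` cut S) (S a) (S b) p.
Proof.
move=> conn a b; have [p] := conn a b.
elim: p a => [|s p IH] a /= => [->|[<- /IH[q wq]]]; first by exists [::].
suff [r wr] : exists r,
    walk S (~` cut S) (S (step_source s)) (S (step_target s)) r.
  by exists (r ++ q); apply: walk_cat wr wq.
have [Cs|nCs] := pselect (cut S s.1); last by exists [:: s].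
have [r /(@walk_sub _ _ _ _ _ (~` cut S)) wr] := cut_bridged Cs.
have {}wr := wr (fun _ x => proj1 x).
case: s {wq} Cs wr => e [] /= _ wr; first by exists r.
by exists (rev (map (@flip _ _ _) r)); apply: walk_rev.
Qed.

Section Limit.
Variables (I : Type) (i0 : I) (F : I -> stage).
Hypothesis F_directed : forall i j, exists k,
  stage_le (F i) (F k) /\ stage_le (F j) (F k).
Hypothesis F_stable : forall v, exists i, forall j,
  stage_le (F i) (F j) -> F j v = F i v.

(** Closed walks, like the values of [fold], only see finitely many vertices and
edges, so they already live at some stage; and the walks bridging a cut edge
consist of safe edges, which no later stage cuts. *)
Lemma stage_limit : exists S : stage,
  (forall i, stage_le (F i) S) /\ forall v, exists i, S v = F i v.
Proof.
have [idx idxP] := choice F_stable.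
pose f v := F (idx v) v.
pose C : set (edges T) := [set e | exists i, cut (F i) e].
have eventually2 v w : exists i, forall j, stage_le (F i) (F j) ->
    F j v = f v /\ F j w = f w.
  have [k [lev lew]] := F_directed (idx v) (idx w).
  exists k => j lej; split; apply: idxP; apply: stage_le_trans lej; assumption.
have fF i v : f (F i v) = f v.
  have [k kP] := eventually2 v (F i v).
  have [l [lekl leil]] := F_directed k i.
  have [<- <-] := kP _ lekl; by case: leil.
have fG g v : f (act g v) = act g (f v).
  have [k kP] := eventually2 v (act g v).
  have [<- <-] := kP _ (stage_le_refl _); exact: fold_act.
have fU u : inU u -> f u = u by move=> Uu; apply: fold_U.
have fI v : f (f v) = f v by rewrite {2}/f fF.
have safeC i e : safe (F i) (cut (F i)) e -> ~ C e.
  move=> se [j Cj]; have [k [[_ _ leik] [_ lejk _]]] := F_directed i j.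
  by apply: leik se _; apply: lejk.
have safeF i : safe (F i) (cut (F i)) `<=` safe f C.
  move=> e se; split; first exact: safeC se.
  by case: se => _; apply: tight_map.
have CG g e : C e -> C (act g e) by case=> i Ci; exists i; apply: cut_act.
have Cbridged e : C e ->
    exists p, walk f (safe f C) (f (iota_v e)) (f (tau_v e)) p.
  case=> i /cut_bridged[p wp]; exists p.
  by have := walk_map (fF i) (@safeF i) wp; rewrite !fF.
have walkF a b p : walk f (~` C) a b p ->
    exists i, forall j, stage_le (F i) (F j) -> walk (F j) (~` cut (F j)) a b p.
  elim: p a => [|s p IH] a /= => [->|[nC fs /IH[i iP]]]; first by exists i0.
  have [k kP] := eventually2 (step_source s) (step_target s).
  have [l [leil lekl]] := F_directed i k.
  exists l => j lelj; have [-> ->] := kP _ (stage_le_trans lekl lelj).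
  split=> //; first by move=> Cj; apply: nC; exists j.
  by apply: iP; apply: stage_le_trans leil lelj.
have Cacyclic : acyclic f (~` C).
  move=> a p /walkF[i /(_ _ (stage_le_refl _))].
  exact: stage_acyclic.
exists (Stage fG fI fU CG Cbridged Cacyclic); split; last by move=> v; exists (idx v).
move=> i; split=> //=; last exact: safeC.
by move=> e Ce; exists i.
Qed.

End Limit.

(** Cut the orbit of a loose edge [s] and merge its source with [t]; contracting
[s] is the case where [q] is empty. The walk [q] bridges the cut edge. For
acyclicity, let [c] be a function on the remaining edges, and extend it to the
cut edges so that it sums to zero around the circle formed by [s], [q] and the
merging: a potential of this extension on the old tree takes the same values on
the merged vertices, so it is a potential of [c] on the new graph, and [c] sums
to zero along closed walks. *)
Lemma stage_join S s (t : V) q : connected_graph T ->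
  ~ cut S s.1 -> loose (S (step_source s)) (S (step_target s)) s.1 ->
  walk S (safe S (cut S)) (S (step_target s)) t q ->
  S t = t -> stabilizer (S (step_source s)) `<=` stabilizer t ->
  ~ same_orbit (S (step_source s)) t ->
  exists S' : stage, [/\ stage_le S S', S' (S (step_source s)) = t,
    forall v, ~ same_orbit (S (step_source s)) (S v) -> S' v = S v,
    forall v, S' v = S v \/ same_orbit t (S' v) &
    forall e, cut S' e <-> cut S e \/ same_orbit s.1 e].
Proof.
set a := S (step_source s); set b := S (step_target s).
move=> conn ncs lab wq St stab_at norb_at.
have [nUa stab_as norb_ab] := lab.
have /choice[sg sgP] : forall v, exists v',
    (forall g, v = act g a -> v' = act g t) /\ (~ same_orbit a v -> v' = v).
  move=> v; have [[g ->]|nav] := pselect (same_orbit a v).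
    exists (act g t); split=> [h E|[]]; last by exists g.
    have /stab_at : stabilizer a (h^-1 * g) by rewrite /stabilizer /= actM E actK.
    by rewrite /stabilizer /= actM => E'; rewrite -{2}E' actKV.
  by exists v; split=> // g E; case: nav; exists g.
have sg_orb g : sg (act g a) = act g t by apply: (sgP _).1.
have sg_id v : ~ same_orbit a v -> sg v = v by apply: (sgP _).2.
have sgG g v : sg (act g v) = act g (sg v).
  have [[h ->]|nav] := pselect (same_orbit a v); first by rewrite -actM !sg_orb actM.
  by rewrite !sg_id // => /same_orbit_actV.
have norb_agt g : ~ same_orbit a (act g t) by move=> /same_orbit_actV.
pose f v := sg (S v).
pose C : set (edges T) := [set e | cut S e \/ same_orbit s.1 e].
have Sa : S a = a by apply: fold_idem.
have fS v : f (S v) = f v by rewrite /f fold_idem.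
have fG g v : f (act g v) = act g (f v) by rewrite /f fold_act sgG.
have fU u : inU u -> f u = u.
  move=> Uu; rewrite /f fold_U // sg_id // => -[g E]; apply: nUa.
  by have := gsubset_closed g^-1 Uu; rewrite E actK.
have fI v : f (f v) = f v.
  rewrite {2 3}/f; have [[g ->]|nav] := pselect (same_orbit a (S v)).
    by rewrite sg_orb fG /f St (sg_id t) // => /norb_at.
  by rewrite (sg_id (S v)) // /f fold_idem sg_id.
have CG g e : C e -> C (act g e).
  by case=> [/(cut_act g)|/(same_orbit_act g)] ?; [left|right].
have nsafe_s : ~ safe S (cut S) s.1.
  case=> _ [t1 t2]; move: t1 t2 lab; rewrite /a /b.
  by case: (s) => e [] /= t1 t2 lab; [apply: t1|apply: t2].
have safe_nC e : safe S (cut S) e -> ~ C e.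
  move=> se [Ce|[g E]]; first by case: se.
  by apply: nsafe_s; have := safe_act g^-1 se; rewrite E actK.
have safeS : safe S (cut S) `<=` safe f C.
  move=> e se; split; first exact: safe_nC.
  by case: se => _; apply: tight_map.
have Cbridged e : C e ->
    exists p, walk f (safe f C) (f (iota_v e)) (f (tau_v e)) p.
  case=> [/cut_bridged[p wp]|[g ->]].
    by exists p; have := walk_map fS safeS wp; rewrite !fS.
  have := walk_act (fold_act S g) (@safe_act S g) wq.
  have ft : f t = t by rewrite /f St sg_id.
  have fa : f (step_source s) = t by rewrite /f -/a -(act1 a) sg_orb act1.
  have fb : f b = f (step_target s) by apply: fS.
  move=> /(walk_map fS safeS); rewrite iota_act tau_act !fG ft fb -fa.
  set r := map _ _ => wr; case: (s) wr => e' [] /= wr; last by exists r.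
  by exists (rev (map (@flip _ _ _) r)); apply: walk_rev.
have Cacyclic : acyclic f (~` C).
  move=> v p wp c.
  have /choice[h hP] : forall e, exists g, same_orbit s.1 e -> e = act g s.1.
    move=> e; have [[g ->]|n] := pselect (same_orbit s.1 e); first by exists g.
    by exists 1 => /n.
  pose c' e := if `[< same_orbit s.1 e >] then xsum c (map (act_step (h e)) q)
               else c e.
  have [x xP] := acyclic_potential c' (stage_connected S conn a) (@stage_acyclic S).
  have c'q g : xsum c' (map (act_step g) q) = xsum c (map (act_step g) q).
    have {wq} : forall s', List.In s' q -> ~ C s'.1.
      by move=> s' /(walk_edge wq); apply: safe_nC.
    elim: (q) => [|s' q' IH] nC /=; first by rewrite !xsum_nil.
    rewrite !xsum_cons IH; last by move=> s2 s2q; apply: nC; right.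
    congr (_ (+) _); rewrite /c'; case: asboolP => //= /same_orbit_actV o.
    by case: (nC s' (or_introl erefl)); right.
  have xa g : x (act g a) = x (act g t).
    have os : same_orbit s.1 (act g s.1) by exists g.
    have Eh := hP _ os; set k := h _ in Eh.
    have : stabilizer s.1 (k^-1 * g) by rewrite /stabilizer /= actM Eh actK.
    move=> /(stabilizer_source S); rewrite -/a => E1; have := stab_at _ E1; move: E1.
    rewrite /stabilizer /= !actM => E1 E2.
    have -> : act g a = act k a by rewrite -{2}E1 actKV.
    have -> : act g t = act k t by rewrite -{2}E2 actKV.
    have wq' := walk_act (fold_act S k) (@uncut_act S k)
      (walk_sub (fun _ x => proj1 x) wq).
    have := xsum_walk xP wq'; rewrite c'q.
    have c'k : c' (act k s.1) = xsum c (map (act_step k) q).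
      by rewrite /c' -Eh asboolT.
    have := xP (act k s.1); rewrite c'k iota_act tau_act !fold_act.
    have -> : x (act k (S (iota_v s.1))) (+) x (act k (S (tau_v s.1))) =
              x (act k a) (+) x (act k b).
      by rewrite /a /b; case: (s) => e [] //=; rewrite addbC.
    move=> <-; last by apply: uncut_act.
    by rewrite [RHS]addbC; case: (x _); case: (x _); case: (x _).
  have xf w : x (f w) = x (S w).
    rewrite /f; have [[g ->]|n] := pselect (same_orbit a (S w)).
      by rewrite sg_orb xa.
    by rewrite sg_id.
  rewrite (xsum_walk (x := x) _ wp) ?addbb // => e nCe.
  rewrite !xf xP; first by rewrite /c' asboolF // => o; apply: nCe; right.
  by move=> Ce; apply: nCe; left.
exists (Stage fG fI fU CG Cbridged Cacyclic); split=> //=.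
- by split=> //= e Ce; left.
- by rewrite /f Sa -(act1 a) sg_orb act1.
- by move=> v; apply: sg_id.
- move=> v; rewrite /f; have [[g ->]|n] := pselect (same_orbit a (S v)).
    by right; exists g; rewrite sg_orb.
  by left; rewrite sg_id.
Qed.

(** * Folding a vertex into the retract *)

(** The walk [p] never returns to its first vertex [a], so its first edge is the
only one of its edges that has [a] as an end. The closed walk made of [p] and of
the inverse of its translate by [g] crosses each edge an even number of times,
hence the translate also crosses that edge, which can only be as its own first
edge. *)
Lemma walk_shortest_fixed S g a b p : walk S (~` cut S) a b p ->
  (forall p', walk S (~` cut S) a b p' -> (size p <= size p')%N) ->
  act g a = a -> act g b = b -> forall s, List.In s p -> act g s.1 = s.1.
Proof.
move=> + + ga gb; elim: p a ga => // s q IH a ga wp short.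
have [ncs Ss wq] := wp.
have noret s' : List.In s' (s :: q) -> S (step_target s') <> a.
  move=> /(walk_suffix wp)[q' wq' lt] E; rewrite E in wq'.
  by have := short _ wq'; rewrite leqNgt lt.
have noret_source s' : List.In s' q -> S (step_source s') <> a.
  move=> s'q; have [->|[s2 s2q ->]] := walk_source wq s'q.
    by apply: noret; left.
  by apply: noret; right.
pose c e := `[< e = s.1 >].
have gs s' : List.In s' (s :: q) -> act g s'.1 = s.1 -> s' = s.
  move=> [-> //|s'q] E; have E' : s'.1 = act g^-1 s.1 by rewrite -E actK.
  have : S (step_source (s'.1, s.2)) = a.
    have -> : (s'.1, s.2) = act_step g^-1 s by rewrite /act_step E'.
    by rewrite source_act fold_act Ss -{1}ga actK.
  have := noret _ (or_intror s'q); have := noret_source _ s'q.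
  case: s' {s'q E E'} => e' d'.
  case: s {wp short ncs Ss wq noret noret_source IH c} => e d /=.
  by case: d d' => [] [].
have /(_ c) : forall c, xsum c (s :: q) = xsum c (map (act_step g) (s :: q)).
  move=> c0; have wg := walk_act (fold_act S g) (@uncut_act S g) wp.
  rewrite ga gb in wg; have := stage_acyclic (walk_cat wp (walk_rev wg)) c0.
  by rewrite xsum_cat xsum_rev; case: (xsum _ _); case: (xsum _ _).
rewrite [LHS]xsum_cons [xsum c q]xsum0; last first.
  move=> s' s'q; apply/asboolF => E.
  have := noret _ (or_intror s'q); have := noret_source _ s'q; move: E Ss.
  case: s' {s'q} => e' d'.
  case: s {wp short ncs wq noret noret_source IH c gs} => e d /= -> <-.
  by case: d d' => [] [].
rewrite /c asboolT // addbF => csum.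
have ges : act g s.1 = s.1.
  apply: contrapT => nge; move: csum; rewrite xsum0 // => s0 s0in.
  have [s' s'in ->] := In_mapP s0in.
  apply/asboolF => E; have Es := gs _ s'in E; apply: nge.
  by rewrite -[in LHS]Es.
move=> s' [<- //|]; apply: (IH _ _ wq).
- exact: (stabilizer_target S ges).
- move=> p' wp'; have : walk S (~` cut S) a b (s :: p') by split.
  by move/short.
Qed.

(** Vertices that move between [S] and [S'] land in [U] or in the orbits of the
finitely many vertices of [L], which remain to be dealt with. *)
Definition moved_into S S' (L : seq V) := forall v,
  [\/ S' v = S v, inU (S' v) | exists2 x, List.In x L & same_orbit x (S' v)].

Lemma moved_into_trans S1 S2 S3 L L' :
  moved_into S1 S2 L -> moved_into S2 S3 L' -> moved_into S1 S3 (L ++ L').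
Proof.
move=> m12 m23 v; have [E|U3|[x xL o]] := m23 v; last 2 first.
- by constructor 2.
- by constructor 3; exists x => //; apply: List.in_or_app; right.
rewrite E; have [->|U2|[x xL o]] := m12 v; first by constructor 1.
- by constructor 2.
- by constructor 3; exists x => //; apply: List.in_or_app; left.
Qed.

Hypothesis T_tree : is_gtree T.
Hypothesis T_fin : finite_edge_stabilizers T.
Hypothesis U_retract : gretract U.

Lemma same_orbit_U x u : inU u -> same_orbit x u -> inU x.
Proof. by move=> Uu [g E]; rewrite -(actK g x) -E; apply: gsubset_closed. Qed.

(** The walk [p] may be taken shortest among the walks from [w] to any suitable
vertex of [U], by induction on its length; the same induction disposes of a
loose edge beyond the first, since contracting it shortens the walk. *)
Lemma stage_step n S (w u : V) p : S w = w -> ~ inU w -> inU u ->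
  stabilizer w `<=` stabilizer u -> walk S (~` cut S) w u p ->
  (size p < n)%N ->
  exists S' L, [/\ stage_le S S', inU (S' w) & moved_into S S' L].
Proof.
elim: n S u p => // n IH S u p Sw nUw Uu stab_wu wp; rewrite ltnS => szp.
have [[u' [p' [Uu' stab_wu' wp' lt]]]|short] := pselect (exists u' p', [/\
    inU u', stabilizer w `<=` stabilizer u',
    walk S (~` cut S) w u' p' & (size p' < size p)%N]).
  by apply: IH wp' _ => //; apply: leq_trans lt szp.
have fixp g : stabilizer w g -> forall s, List.In s p -> stabilizer s.1 g.
  move=> gw; apply: (walk_shortest_fixed wp) => //; last exact: stab_wu.
  move=> p' wp'; rewrite leqNgt; apply/negP => lt; apply: short.
  by exists u, p'.
case: p wp szp short fixp => [/= E|s q]; first by rewrite E in nUw.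
move=> wp szp short fixp; have [ncs Ss wq] := wp.
have fin_w : finite_set (stabilizer w).
  by apply: sub_finite_set (T_fin s.1) => g gw; apply: (fixp g gw); left.
have norb s' : List.In s' (s :: q) -> ~ same_orbit w (S (step_target s')).
  move=> s'p [h E]; apply: short.
  have [q' wq' lt] := walk_suffix wp s'p.
  have stab_w_hw : stabilizer w `<=` stabilizer (act h w).
    by move=> g gw; rewrite -E; apply: (stabilizer_target S); apply: fixp.
  have stab_hw_w := stabilizer_orbit_eq fin_w stab_w_hw.
  have := walk_act (fold_act S h^-1) (@uncut_act S h^-1) wq'.
  rewrite E actK => wq2; eexists; eexists; split; last 2 first.
  - exact: wq2.
  - by rewrite size_map.
  - exact: gsubset_closed.
  - move=> g gw; apply/stabilizer_act; apply: stab_wu; apply: stab_hw_w.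
    by apply/stabilizer_act; rewrite invgK !mulgA mulVg mul1g -mulgA mulVg mulg1.
have norb_source s' : List.In s' q -> ~ same_orbit w (S (step_source s')).
  move=> s'q; have [->|[s2 s2q ->]] := walk_source wq s'q.
    by apply: norb; left.
  by apply: norb; right.
have [[s' [s'q nt]]|alltight] :=
  pselect (exists s', List.In s' q /\ ~ tight S s'.1).
  have [s2 [Es2 l nw]] : exists s2, [/\ s2.1 = s'.1,
      loose (S (step_source s2)) (S (step_target s2)) s2.1 &
      ~ same_orbit w (S (step_source s2))].
    have l : loose (S (step_source s')) (S (step_target s')) s'.1 \/
             loose (S (step_target s')) (S (step_source s')) s'.1.
      have : loose (S (iota_v s'.1)) (S (tau_v s'.1)) s'.1 \/
             loose (S (tau_v s'.1)) (S (iota_v s'.1)) s'.1.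
        by apply: contrapT => h; apply: nt; split=> l; apply: h; [left|right].
      by case: (s') => e [] //= [] l; [right|left].
    case: l => l; first by exists s'; split=> //; apply: norb_source.
    exists (flip s'); rewrite source_flip target_flip; split=> //.
    by apply: norb; right.
  have ncs2 : ~ cut S s2.1 by rewrite Es2; apply: walk_edge wq s'q.
  have [_ stab_a norb_a] := l.
  have stab_at :
      stabilizer (S (step_source s2)) `<=` stabilizer (S (step_target s2)).
    by move=> g /stab_a; apply: (stabilizer_target S).
  have [S1 [leS1 S1a S1id S1mv S1cut]] := stage_join (proj1 T_tree) ncs2 l
    (q := [::]) (erefl _) (fold_idem S _) stab_at norb_a.
  have [SS1 cutS1 _] := leS1.
  have S1w : S1 w = w by rewrite S1id Sw // => /same_orbit_sym.
  have S1s2 : S1 (step_source s2) = S1 (step_target s2).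
    by rewrite -(SS1 (step_source s2)) S1a S1id.
  have S1D e : same_orbit s2.1 e -> S1 (iota_v e) = S1 (tau_v e).
    case=> g ->; rewrite iota_act tau_act !fold_act; congr (act g _).
    by case: (s2) S1s2 => e' [].
  have := walk_collapse SS1 S1D wp; rewrite S1w (fold_U S1 Uu).
  have subcut : ~` cut S `\` same_orbit s2.1 `<=` ~` cut S1.
    by move=> e [nce noe] /S1cut[].
  move=> /(walk_sub subcut) wp1.
  have lt1 := size_collapse (D := same_orbit s2.1)
    (or_intror s'q : List.In s' (s :: q)).
  have {}lt1 : (size [seq s <- s :: q | `[< ~ same_orbit s2.1 s.1 >]] < n)%N.
    by apply: leq_trans szp; apply: lt1; rewrite Es2; apply: same_orbit_refl.
  have [S' [L [leS' S'w mvL]]] := IH _ _ _ S1w nUw Uu stab_wu wp1 lt1.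
  exists S', ([:: S (step_target s2)] ++ L); split=> //.
    exact: stage_le_trans leS'.
  apply: moved_into_trans mvL => v; have [|o] := S1mv v; first by constructor 1.
  by constructor 3; exists (S (step_target s2)); [left|].
have wq_safe : walk S (safe S (cut S)) (S (step_target s)) u q.
  apply: (walk_all _ wq) => s' s'q; split; first exact: walk_edge wq s'q.
  by apply: contrapT => nt; apply: alltight; exists s'.
have l : loose (S (step_source s)) (S (step_target s)) s.1.
  rewrite Ss; split=> //; last by apply: norb; left.
  by move=> g gw; apply: (fixp g gw); left.
have norb_wu : ~ same_orbit (S (step_source s)) u.
  by rewrite Ss => /(same_orbit_U Uu).
rewrite -Ss in stab_wu.
have [S' [leS' S'w _ S'mv _]] :=
  stage_join (proj1 T_tree) ncs l wq_safe (fold_U S Uu) stab_wu norb_wu.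
exists S', [::]; rewrite -Ss S'w; split=> // v.
have [|[g ->]] := S'mv v; first by constructor 1.
by constructor 2; apply: gsubset_closed.
Qed.

(** * Limits of stages *)

Lemma stage_steps L S : exists S' L',
  [/\ stage_le S S', forall x, List.In x L -> inU (S' x) & moved_into S S' L'].
Proof.
elim: L S => [|x L IH] S.
  by exists S, [::]; split=> //; [apply: stage_le_refl|constructor 1].
suff [S1 [L1 [le1 U1 mv1]]] : exists S1 L1,
    [/\ stage_le S S1, inU (S1 x) & moved_into S S1 L1].
  have [S2 [L2 [le2 U2 mv2]]] := IH S1.
  exists S2, (L1 ++ L2); split.
  - exact: stage_le_trans le2.
  - move=> y [<-|/U2 //]; case: le2 => le2 _ _.
    by rewrite -le2 fold_U.
  - exact: moved_into_trans mv2.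
have [Ux|nUx] := pselect (inU (S x)).
  by exists S, [::]; split=> //; [apply: stage_le_refl|constructor 1].
have [u Uu stab_u] := U_retract nUx.
have [p] := stage_connected S (proj1 T_tree) x u; rewrite (fold_U S Uu) => wp.
have [S1 [L1 [le1 U1 mv1]]] :=
  stage_step (fold_idem S x) nUx Uu stab_u wp (ltnSn _).
by exists S1, L1; split=> //; case: le1 U1 => ->.
Qed.

(** Unlike arbitrary stages, the full ones along a chain move each vertex at
most once, which gives the chain a limit. *)
Definition full S := forall v, inU (S v) \/ S v = v.

(** At each round, fold into [U] the finitely many orbits where the previous
round left vertices outside [U]. A vertex that moves for the first time at round
[n] thus lies in [U] after round [n + 1], and stays there. *)
Lemma full_extension S w : full S -> exists S',
  [/\ stage_le S S', full S' & inU (S' w)].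
Proof.
move=> fullS.
have /choice[next nextP] : forall x : stage * seq V, exists y : stage * seq V,
    [/\ stage_le x.1 y.1, forall v, List.In v x.2 -> inU (y.1 v) &
        moved_into x.1 y.1 y.2].
  by case=> S1 L1; have [S2 [L2 H]] := stage_steps L1 S1; exists (S2, L2).
pose F n := iter n next (S, [:: w]).
have F_le m n : (m <= n)%N -> stage_le (F m).1 (F n).1.
  move=> /subnKC <-; elim: (n - m)%N => [|k IH].
    by rewrite addn0; apply: stage_le_refl.
  by rewrite addnS; apply: stage_le_trans IH _; have [] := nextP (F (m + k)).
have F_dich v : (forall n, (F n).1 v = S v) \/ exists n, inU ((F n).1 v).
  have [|nU] := pselect (exists n, inU ((F n).1 v)); first by right.
  left; elim=> [//|n IH].
  have [_ _ mv] := nextP (F n); have [E|Un|[x xL [g E]]] := mv v.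
  - by rewrite -IH -E.
  - by case: nU; exists n.+1.
  - case: nU; exists n.+2; have [[le12 _ _] UL _] := nextP (F n.+1).
    rewrite -[(F n.+2).1 v]le12 E fold_act.
    by apply: gsubset_closed; apply: UL.
have F_stable v : exists i, forall j, stage_le (F i).1 (F j).1 ->
    (F j).1 v = (F i).1 v.
  have [all|[n Un]] := F_dich v; first by exists 0%N => j _; rewrite !all.
  by exists n => j [<- _ _]; rewrite fold_U.
have F_directed i j : exists k,
    stage_le (F i).1 (F k).1 /\ stage_le (F j).1 (F k).1.
  by exists (maxn i j); split; apply: F_le; rewrite ?leq_maxl ?leq_maxr.
have [S' [leS' S'v]] := stage_limit 0%N F_directed F_stable.
exists S'; split; first exact: (leS' 0%N).
- move=> v; have [all|[n Un]] := F_dich v.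
    by have [i ->] := S'v v; rewrite all.
  by left; have [<- _ _] := leS' n; rewrite fold_U.
- have [_ Uw _] := nextP (F 0%N).
  have {}Uw : inU ((F 1%N).1 w) by apply: Uw; left.
  by have [<- _ _] := leS' 1%N; rewrite fold_U.
Qed.

Lemma full_limit (A : set {S : stage | full S}) (S0 : {S : stage | full S}) :
  total_on A (fun x y => stage_le (sval x) (sval y)) ->
  exists S : {S : stage | full S}, forall x, A x -> stage_le (sval x) (sval S).
Proof.
move=> tot; have [[x0 Ax0]|nA] := pselect (exists x, A x); last first.
  by exists S0 => x Ax; case: nA; exists x.
pose I := {x | A x}; pose F (i : I) := sval (sval i).
have F_directed (i j : I) : exists k,
    stage_le (F i) (F k) /\ stage_le (F j) (F k).
  have [le|le] := tot _ _ (proj2_sig i) (proj2_sig j); [exists j|exists i];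
    by split=> //; apply: stage_le_refl.
have F_dich v : (forall i, F i v = v) \/ exists i, inU (F i v).
  have [|nU] := pselect (exists i, inU (F i v)); first by right.
  left=> i; have [Ui|//] := proj2_sig (sval i) v.
  by case: nU; exists i.
have i0 : I by exists x0.
have F_stable v : exists i, forall j, stage_le (F i) (F j) -> F j v = F i v.
  have [all|[i Ui]] := F_dich v; first by exists i0 => j _; rewrite !all.
  by exists i => j [<- _ _]; rewrite fold_U.
have [S' [leS' S'v]] := stage_limit i0 F_directed F_stable.
have fullS' : full S'.
  move=> v; have [all|[i Ui]] := F_dich v.
    by right; have [i ->] := S'v v; rewrite all.
  by left; have [<- _ _] := leS' i; rewrite fold_U.
by exists (exist _ S' fullS') => x Ax; apply: (leS' (exist _ x Ax)).
Qed.

Lemma stage0_subproof e : (set0 : set (edges T)) e ->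
  exists p, walk id (safe id set0) (iota_v e) (tau_v e) p.
Proof. by []. Qed.

Lemma stage0_acyclic : acyclic id (~` (set0 : set (edges T))).
Proof. by rewrite setC0; apply: acyclic_of_circuit_free; case: T_tree. Qed.

Definition stage0 := @Stage id set0 (fun _ _ => erefl) (fun _ => erefl)
  (fun _ _ => erefl) (fun _ _ F => F) stage0_subproof stage0_acyclic.

Lemma complete_stage_exists : exists S : stage, forall v, inU (S v).
Proof.
have full0 : full stage0 by right.
pose X := {S : stage | full S}.
have [||A|[S fullS] maxS] := @ZL_preorder X (exist _ _ full0)
    (fun x y => `[< stage_le (sval x) (sval y) >]).
- by move=> S; apply/asboolP; apply: stage_le_refl.
- by move=> S1 S2 S3 /asboolP l1 /asboolP l2; apply/asboolP; apply: stage_le_trans l2.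
- move=> tot; have [|S SP] := @full_limit A (exist _ _ full0).
    move=> S1 S2 A1 A2.
    by case: (tot _ _ A1 A2) => /asboolP; [left|right].
  by exists S => x /SP ?; apply/asboolP.
exists S => v; have [//|Sv] := fullS v; rewrite Sv.
have [S' [leS' fullS' Uv]] := full_extension v fullS.
have /asboolP[/= leS _ _] : `[< stage_le (sval (exist _ S' fullS' : X)) S >].
  by apply: maxS; apply/asboolP.
have := leS v; rewrite Sv (fold_U S Uv) => E.
by rewrite -E.
Qed.

End Stages.

(** * The tree of a complete stage *)

Section FinalTree.
Variables (G : groupType) (V : gset G) (T : ggraph V) (U : gsubset V).
Variables (S : stage T U) (S_U : forall v, gsubset_set U (S v)).

Let UV := gset_of_gsubset U.
Let E' := gset_of_gsubset (GSubset (@uncut_act _ _ _ _ S)).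

Let end_in_U (x : edges T -> V) (e : E') : UV :=
  SigSub (mem_set (S_U (x (val e)))).

Lemma stage_graph_nonempty : exists v : UV, True.
Proof.
by have [v _] := ggraph_nonempty T; exists (SigSub (mem_set (S_U v))).
Qed.

Lemma stage_graph_iota_act g e : end_in_U (@iota_v _ _ T) (act g e) =
  act g (end_in_U (@iota_v _ _ T) e).
Proof. by apply: val_inj; rewrite /= iota_act fold_act. Qed.

Lemma stage_graph_tau_act g e : end_in_U (@tau_v _ _ T) (act g e) =
  act g (end_in_U (@tau_v _ _ T) e).
Proof. by apply: val_inj; rewrite /= tau_act fold_act. Qed.

Definition stage_graph : ggraph UV :=
  GGraph stage_graph_nonempty stage_graph_iota_act stage_graph_tau_act.

Let valU (u : UV) : V := \val (u : set_type U).

Let lower (s : step stage_graph) : step T := (val s.1, s.2).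

Let lower_source s : valU (step_source s) = S (step_source (lower s)).
Proof. by case: s => e []. Qed.

Let lower_target s : valU (step_target s) = S (step_target (lower s)).
Proof. by case: s => e []. Qed.

Lemma stage_graph_walk a b (p : seq (step stage_graph)) :
  is_walk a b p -> walk S (~` cut S) (valU a) (valU b) (map lower p).
Proof.
elim: p a => [|s p IH] a /= => [-> //|[<- /IH wp]].
rewrite lower_source -lower_target; split=> //.
exact: (set_valP s.1).
Qed.

Lemma stage_graph_lift a b p : walk S (~` cut S) (valU a) (valU b) p ->
  exists p', is_walk (T := stage_graph) a b p'.
Proof.
elim: p a => [|[e d] p IH] a /= => [/val_inj ->|[nce Ea]]; first by exists [::].
pose s : step stage_graph := (SigSub (mem_set (nce : (~` cut S) e)) : E', d).
rewrite -[S _](lower_target s) => /IH[p' wp']; exists (s :: p'); split=> //.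
by apply: val_inj; apply: etrans (lower_source s) Ea.
Qed.

Lemma stage_graph_tree : connected_graph T -> is_gtree stage_graph.
Proof.
move=> conn; split.
  move=> a b; have [p] := stage_connected S conn (valU a) (valU b).
  by rewrite !fold_U; [apply: stage_graph_lift|apply: set_valP|apply: set_valP].
move=> p [pn0 [v /stage_graph_walk wp] _ nd].
have := stage_acyclic wp.
case: p pn0 nd {wp} => // s p _ nd.
(* The first edge of the circuit is crossed once. *)
have [nsp _] := (List.NoDup_cons_iff _ _).1 nd.
move=> /(_ (fun e => `[< e = val s.1 >])).
rewrite /= xsum_cons asboolT // xsum0 // => s0 s0p.
have [s1 s1p ->] := In_mapP s0p.
apply/asboolF => /val_inj E; apply: nsp; rewrite -E.
exact: List.in_map.
Qed.

Lemma stage_graph_finite : finite_edge_stabilizers T ->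
  finite_edge_stabilizers stage_graph.
Proof.
move=> fin e; apply: sub_finite_set (fin (val e)) => g ge.
by rewrite /stabilizer /= -{2}ge.
Qed.

End FinalTree.

Theorem mainTheorem1 (G : groupType) (V : gset G) (T : ggraph V)
    (T_tree : is_gtree T) (T_fin : finite_edge_stabilizers T)
    (U : gsubset V) (U_retract : gretract U) :
  exists T' : ggraph (gset_of_gsubset U),
    is_gtree T' /\ finite_edge_stabilizers T'.
Proof.
have [S S_U] := complete_stage_exists T_tree T_fin U_retract.
exists (stage_graph S_U); split.
- by apply: stage_graph_tree; case: T_tree.
- exact: stage_graph_finite.
Qed.
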